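(* Let $F_n$ be the free group of finite rank $n$ and let $H$ be a finitely generated subgroup of infinite index of $F_n$. Then $H$ is $\oplus$-cocyclic if and only if it is $\vee$-cocyclic.
   Context: For subgroups $H,K$ of $F_n$, $H\vee K=\langle H\cup K\rangle$ denotes their join. $K$ is a $\vee$-complement of $H$ if $H\vee K=F_n$; it is a $\oplus$-complement of $H$ if $H\vee K=F_n$ and $H\cap K=\{1\}$. $H$ is $\vee$-cocyclic (resp. $\oplus$-cocyclic) if it admits a cyclic $\vee$-complement (resp. a cyclic $\oplus$-complement), i.e. if there is $u\in F_n$ such that $\langle u\rangle$ is a complement of $H$ of the corresponding kind. *)

(* Defs.v *)
From HB Require Import structures.
From mathcomp Require Import all_boot.
From mathcomp Require Import all_classical.

Set Implicit Arguments.
Unset Strict Implicit.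
Unset Printing Implicit Defensive.

Local Open Scope classical_set_scope.
Local Open Scope group_scope.

(* The letter (x, false) stands for the generator x and (x, true) for its
   inverse. *)
Definition letter (T : Type) : Type := (T * bool)%type.

Definition letter_inv (T : Type) (a : letter T) : letter T := (a.1, ~~ a.2).

Lemma letter_invK (T : Type) : involutive (@letter_inv T).
Proof. by case=> x b; rewrite /letter_inv /= negbK. Qed.

Definition reduced (T : eqType) (w : seq (letter T)) : bool :=
  sorted (fun a b => b != letter_inv a) w.

Record free_group (T : choiceType) : Type :=
  FreeGroup { word_of :> seq (letter T); _ : reduced word_of }.

HB.instance Definition _ (T : choiceType) := [isSub for @word_of T].
HB.instance Definition _ (T : choiceType) := [Choice of free_group T by <:].

Section FreeGroupLaw.
Variable T : choiceType.
Implicit Types (a b : letter T) (u v w : seq (letter T)) (x y z : free_group T).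

(* word_push a w is the reduced form of a :: w, provided w is reduced. *)
Definition word_push a w : seq (letter T) :=
  if w is b :: w' then if b == letter_inv a then w' else a :: w else [:: a].

Definition word_mul u v : seq (letter T) := foldr word_push v u.

Definition word_inv w : seq (letter T) := rev (map (@letter_inv T) w).

Lemma word_push_reduced a w : reduced w -> reduced (word_push a w).
Proof.
case: w => [|b w] //= ww; case: eqP => [_|/eqP ne]; last by rewrite /reduced /= ne.
exact: path_sorted ww.
Qed.

Lemma word_pushK a w :
  reduced w -> word_push a (word_push (letter_inv a) w) = w.
Proof.
case: w => [|b w] /=; first by rewrite eqxx.
rewrite letter_invK; have [->|ne] := eqVneq b a; last by rewrite /= eqxx.
by case: w => [|c w] //= /andP[/negPf->].
Qed.

Lemma word_mul_reduced u v : reduced v -> reduced (word_mul u v).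
Proof. by move=> rv; elim: u => //= a u; apply: word_push_reduced. Qed.

Lemma word_mulw1 w : reduced w -> word_mul w [::] = w.
Proof.
elim: w => [|a w IHw] //= rw; rewrite IHw; last exact: path_sorted rw.
by case: w rw {IHw} => [|b w] //= /andP[/negPf->].
Qed.

Lemma word_mul_push a u w :
  reduced w -> word_mul (word_push a u) w = word_push a (word_mul u w).
Proof.
move=> rw; case: u => [|b u] //=; case: eqP => [->|_] //=.
by rewrite word_pushK //; apply: word_mul_reduced.
Qed.

Lemma word_mulA u v w :
  reduced w -> word_mul u (word_mul v w) = word_mul (word_mul u v) w.
Proof. by move=> rw; elim: u => //= a u ->; rewrite word_mul_push. Qed.

Lemma word_mulVw w : word_mul (word_inv w) w = [::].
Proof.
elim: w => //= a w IHw.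
by rewrite /word_mul /word_inv /= rev_cons foldr_rcons /= letter_invK eqxx.
Qed.

Lemma word_invK : involutive word_inv.
Proof. by move=> w; rewrite /word_inv map_rev revK (mapK (@letter_invK T)). Qed.

Lemma word_inv_reduced w : reduced w -> reduced (word_inv w).
Proof.
rewrite /reduced /word_inv rev_sorted sorted_map => rw.
apply: sub_sorted rw => a b; apply: contraNneq => /(can_inj (@letter_invK T)) ->.
by rewrite letter_invK.
Qed.

Definition fg_one : free_group T := @FreeGroup T [::] isT.

Definition fg_mul x y : free_group T :=
  FreeGroup (word_mul_reduced x (valP y)).

Definition fg_inv x : free_group T := FreeGroup (word_inv_reduced (valP x)).

Lemma fg_mulA : associative fg_mul.
Proof. by move=> x y z; apply/val_inj/word_mulA/(valP z). Qed.

Lemma fg_mul1g : left_id fg_one fg_mul.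
Proof. by move=> x; apply/val_inj. Qed.

Lemma fg_mulg1 : right_id fg_one fg_mul.
Proof. by move=> x; apply/val_inj/word_mulw1/(valP x). Qed.

Lemma fg_mulVg : left_inverse fg_one fg_inv fg_mul.
Proof. by move=> x; apply/val_inj/word_mulVw. Qed.

Lemma fg_mulgV : right_inverse fg_one fg_inv fg_mul.
Proof.
by move=> x; apply/val_inj => /=; rewrite -{1}[val x]word_invK word_mulVw.
Qed.

HB.instance Definition _ := isGroup.Build (free_group T)
  fg_mulA fg_mul1g fg_mulg1 fg_mulVg fg_mulgV.

Definition fg_gen (t : T) : free_group T := @FreeGroup T [:: (t, false)] isT.

End FreeGroupLaw.

Section UniversalProperty.
Variables (T : choiceType) (G : groupType) (f : T -> G).

Definition eval_letter (a : letter T) : G := if a.2 then (f a.1)^-1 else f a.1.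

Definition fg_lift (x : free_group T) : G := \prod_(a <- x) eval_letter a.

Lemma fg_liftM : {morph fg_lift : x y / x * y}.
Proof.
have evalV a : eval_letter a * eval_letter (letter_inv a) = 1.
  by case: a => t [] /=; rewrite /eval_letter /= ?mulVg ?mulgV.
case=> u ru [v rv]; rewrite /fg_lift /= {ru rv}.
elim: u => [|a u IHu] /=; first by rewrite big_nil mul1g.
rewrite big_cons -mulgA -IHu; case: (word_mul u v) => [|b w] /=.
  by rewrite big_cons.
by case: eqP => [->|_]; rewrite !big_cons // mulgA evalV mul1g.
Qed.

Lemma fg_lift_gen t : fg_lift (fg_gen t) = f t.
Proof. by rewrite /fg_lift big_seq1. Qed.

Lemma fg_lift_unique (g : free_group T -> G) :
  {morph g : x y / x * y} -> (forall t, g (fg_gen t) = f t) -> g =1 fg_lift.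
Proof.
move=> gM gf; have g1 : g 1 = 1.
  by apply: (mulgI (g 1)); rewrite -gM !mulg1.
have gV x : g x^-1 = (g x)^-1.
  by apply: (mulgI (g x)); rewrite -gM !mulgV.
case; elim=> [|a w IHw] rw; rewrite /fg_lift /=.
  by rewrite big_nil -g1; congr g; apply/val_inj.
have rw' := path_sorted rw.
have ra : reduced [:: a] by [].
have -> : FreeGroup rw = FreeGroup ra * FreeGroup rw'.
  by apply/val_inj => /=; case: w rw {IHw rw'} => [|b w] //= /andP[/negPf->].
rewrite gM IHw big_cons; congr (_ * _).
case: a {rw} ra => t [] ra; rewrite /eval_letter /= -gf -?gV;
  by congr g; apply/val_inj.
Qed.

End UniversalProperty.

Definition free_group_rank (n : nat) : groupType := free_group 'I_n.

Section Subgroups.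
Variable G : groupType.
Implicit Types (A H K : set G) (u : G).

Definition is_subgroup H : Prop :=
  [/\ H 1,
      (forall x y, H x -> H y -> H (x * y)) &
      (forall x, H x -> H x^-1)].

Definition generated A : set G := smallest is_subgroup A.

Definition finitely_generated H : Prop := exists s : seq G, H = generated [set` s].

Lemma generated_subgroup A : is_subgroup (generated A).
Proof.
split=> [K [[]]//|x y Hx Hy K [KG AK]|x Hx K [KG AK]].
  by case: (KG) => _ KM _; apply: KM; [apply: Hx|apply: Hy].
by case: (KG) => _ _ KV; apply: KV; apply: Hx.
Qed.

Definition left_coset (x : G) H : set G := [set x * h | h in H].

Definition infinite_index H : Prop :=
  infinite_set (range (fun x : G => left_coset x H)).

Definition subgroup_join H K : set G := generated (H `|` K).

Definition join_complement H K : Prop := subgroup_join H K = [set: G].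

Definition direct_complement H K : Prop :=
  join_complement H K /\ H `&` K = [set 1].

Definition join_cocyclic H : Prop :=
  exists u, join_complement H (generated [set u]).

Definition direct_cocyclic H : Prop :=
  exists u, direct_complement H (generated [set u]).

End Subgroups.

(* Main.v *)
Require Import Defs.
From mathcomp Require Import all_boot all_classical.
From mathcomp Require Import zify.

(** Suppose [H] and [u] generate.  If [H] is trivial there is nothing to do.
  Otherwise look for a complement [v = g u h] with [g], [h] in [H].

  Since [H] is finitely generated, the prefixes of its elements lie within
  bounded distance of [H] in the Cayley graph, so a reduced word that travels far
  away from [H] has a prefix [p] that no element of [H] extends; then no word
  extending [p] is in [H].  It therefore suffices that every positive power of [v]
  extends such a [p].

  The elements [y] for which [y H] and [y^-1 H] stay within bounded distance of
  [H] (modulo [H] on the left) form a subgroup containing [H].  It is not the whole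
  group, because [H] is nontrivial of infinite index; hence it does not contain
  [u], and [h] can be chosen with [u h], or [u^-1 h], arbitrarily far from [H].
  Long elements of [H] do not all start in the same way, so [g] can be chosen with
  little cancellation between the end of [u h] and the start of [g]; this keeps a
  prefix of [g u h], already far from [H], intact in every power of [v]. *)

Set Implicit Arguments.
Unset Strict Implicit.
Unset Printing Implicit Defensive.

Local Open Scope classical_set_scope.
Local Open Scope group_scope.

(** * Joins with a cyclic subgroup *)

Section Cyclic.
Variable G : groupType.
Implicit Types (H K : set G) (u x : G).

Lemma join_cyclicP H u : join_complement H (generated [set u]) <->
  forall K, is_subgroup K -> H `<=` K -> K u -> K = [set: G].
Proof.
split=> [gen K sgK HK Ku|all].
  apply/seteqP; split=> //; rewrite -gen.
  apply: smallest_sub => // x [/HK //|]; apply; split=> //.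
  by move=> _ ->.
apply: all => [|x Hx K [_]|K [_]]; first exact: generated_subgroup.
  by apply; left.
by apply; right => A [_]; apply.
Qed.

Lemma generated_cycle u x :
  generated [set u] x -> exists k, x = u ^+ k \/ x = u ^- k.
Proof.
(* Quotients of natural powers stand in for integer powers. *)
pose K : set G := [set x | exists m n, x = u ^+ m / u ^+ n].
have comm m n : (u ^+ m)^-1 * u ^+ n = u ^+ n / u ^+ m.
  by apply/commute_sym/commuteV/commuteX2.
suff sub : generated [set u] `<=` K.
  move=> /sub[m [n ->]]; case: (leqP n m) => [le_nm|/ltnW le_mn].
    by exists (m - n); left; rewrite expgnFr.
  by exists (n - m); right; rewrite expgnFr // invgF.
apply: smallest_sub => [|_ ->]; last by exists 1%N, 0%N; rewrite expg1 invg1 mulg1.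
split; first by exists 0%N, 0%N; rewrite mulgV.
- move=> _ _ [a [b ->]] [c [d ->]]; exists (a + c), (d + b).
  by rewrite !expgnDr invgM -!mulgA; congr (_ * _); rewrite !mulgA comm.
- by move=> _ [a [b ->]]; exists b, a; rewrite invgF.
Qed.

End Cyclic.

(** * Cancellation and powers of reduced words *)

Section Words.
Variable T : choiceType.
Implicit Types (a b : letter T) (c d e f p q s t u v w : seq (letter T)).
Implicit Types (x y z g h : free_group T).

Lemma size_word_inv w : size (word_inv w) = size w.
Proof. by rewrite size_rev size_map. Qed.

Lemma word_inv_cat u v : word_inv (u ++ v) = word_inv v ++ word_inv u.
Proof. by rewrite /word_inv map_cat rev_cat. Qed.

Lemma cat_eq_suffix s t u v : size t = size v -> s ++ t = u ++ v -> s = u /\ t = v.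
Proof.
move=> stv E; have ssu : size s = size u.
  by have := congr1 size E; rewrite !size_cat stv => /addIn.
by move/eqP: E; rewrite eqseq_cat // => /andP[/eqP-> /eqP->].
Qed.

Lemma prefix_catP q u v : prefix q (u ++ v) ->
  prefix q u \/ exists2 v', q = u ++ v' & prefix v' v.
Proof.
elim: u q => [|a u IHu] [|b q] /=; try by [left | right; exists [::]].
  by right; exists (b :: q).
case: eqP => //= -> /IHu[|[v' -> ?]]; [by left | by right; exists v'].
Qed.

Lemma reduced_catl u v : reduced (u ++ v) -> reduced u.
Proof. by case/cat_sorted2. Qed.

Lemma reduced_catr u v : reduced (u ++ v) -> reduced v.
Proof. by case/cat_sorted2. Qed.

Lemma reduced_glue u v w :
  v != [::] -> reduced (u ++ v) -> reduced (v ++ w) -> reduced (u ++ v ++ w).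
Proof.
case: v => // b v _; case: u => [|a u] //; rewrite /reduced /= !cat_path /=.
by case/and3P=> -> -> _; rewrite cat_path.
Qed.

(** [c] is the block that cancels. A letter added on the left of [u] joins [c] if [p] is empty and
    [q] begins with its inverse; otherwise it joins [p]. *)
Lemma word_mul_cancel u v : reduced u ->
  exists p c q, [/\ u = p ++ c, v = word_inv c ++ q & word_mul u v = p ++ q].
Proof.
elim: u => [|a u IHu] ru; first by exists [::], [::], v.
have [p [c [q [Eu Ev /= ->]]]] := IHu (path_sorted ru).
case: p Eu => [|b p] Eu; last first.
  exists [:: a, b & p], c, q; rewrite Eu Ev; split=> //=.
  by move: ru; rewrite Eu /= => /andP[/negPf->].
case: q Ev => [|b q] Ev.
  by exists [:: a], c, [::]; rewrite Eu Ev.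
rewrite /=; case: eqP => [Eb|_]; last by exists [:: a], c, (b :: q); rewrite Eu Ev.
exists [::], (a :: c), q; split=> //; first by rewrite Eu.
by rewrite Ev -[a :: c]cat1s word_inv_cat -catA Eb.
Qed.

Lemma word_mul_prefix_short s t v : reduced (s ++ t) ->
  size v <= size t -> prefix s (word_mul (s ++ t) v).
Proof.
move=> ru le_vt; have [p [c [q [E Ev ->]]]] := word_mul_cancel v ru.
have le_yp : size s <= size p.
  have := congr1 size E; have := congr1 size Ev.
  by rewrite !size_cat size_word_inv => Sv S; lia.
apply/prefixP; exists (drop (size s) p ++ q); rewrite catA; congr (_ ++ _).
move/(congr1 (take (size s))): E; rewrite take_size_cat // takel_cat // => {1}->.
by rewrite cat_take_drop.
Qed.

(** To reach [s], cancellation would first have to consume all of [t], and [v] would then begin with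
    [word_inv t]. *)
Lemma word_mul_prefix_neq s t f v : reduced (s ++ t) ->
  size f = size t -> f != word_inv t -> prefix f v ->
  prefix s (word_mul (s ++ t) v).
Proof.
move=> ru sz ne /prefixP[v' Ev0]; have [p [c [q [E Ev ->]]]] := word_mul_cancel v ru.
have le_yp : size s <= size p.
  rewrite leqNgt; apply: contra ne => lt_py; apply/eqP.
  have Et : t = drop (size c - size t) c.
    move/(congr1 (drop (size s))): (E); rewrite drop_size_cat // => {1}->.
    rewrite drop_cat ltnNge (ltnW lt_py) /=; congr drop.
    by have := congr1 size E; rewrite !size_cat; lia.
  have Ec : c = take (size c - size t) c ++ t by rewrite [X in _ ++ X]Et cat_take_drop.
  move: Ev; rewrite Ev0 Ec word_inv_cat -catA => /eqP.
  by rewrite eqseq_cat ?size_word_inv // => /andP[/eqP].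
apply/prefixP; exists (drop (size s) p ++ q); rewrite catA; congr (_ ++ _).
move/(congr1 (take (size s))): E; rewrite take_size_cat // takel_cat // => {1}->.
by rewrite cat_take_drop.
Qed.

(** Multiplying by the empty word reduces any word, so prefixes and concatenations become group
    elements without a proof of reducedness. *)
Definition fg_of w : free_group T :=
  FreeGroup (@word_mul_reduced T w [::] isT).

Lemma fg_ofK w : reduced w -> fg_of w = w :> seq _.
Proof. exact: word_mulw1. Qed.

Lemma word_ofK x : fg_of x = x.
Proof. by apply/val_inj/fg_ofK/(valP x). Qed.

Lemma word_ofM x y : x * y = word_mul x y :> seq _.
Proof. by []. Qed.

Lemma word_ofV x : x^-1 = word_inv x :> seq _.
Proof. by []. Qed.

Lemma fg_of_cat u v : fg_of (u ++ v) = fg_of u * fg_of v.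
Proof.
apply/val_inj; rewrite /= -word_mulA //=; last exact: word_mul_reduced.
by rewrite /word_mul foldr_cat.
Qed.

Lemma fg_of_inv w : fg_of (word_inv w) = (fg_of w)^-1.
Proof.
apply: (mulIg (fg_of w)); rewrite mulVg -fg_of_cat; apply/val_inj.
transitivity (word_mul (word_inv w) (word_mul w [::])).
  by rewrite /= {1}/word_mul foldr_cat.
by rewrite word_mulA // word_mulVw.
Qed.

Lemma size_fgM x y : size (x * y) <= size x + size y.
Proof.
have [p [c [q [Ex Ey]]]] := word_mul_cancel y (valP x).
rewrite word_ofM => ->; rewrite [val x]Ex Ey !size_cat.
lia.
Qed.

Lemma size_fgV x : size x^-1 = size x.
Proof. exact: size_word_inv. Qed.

(** Mutually inverse first and last letters are stripped off into [d] until the core [e] is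
    cyclically reduced. *)
Lemma cyclic_decomposition w : reduced w -> w != [::] ->
  exists d e, [/\ w = d ++ e ++ word_inv d, e != [::] & reduced (e ++ e)].
Proof.
have [k] := ubnP (size w); elim: k w => // k IHk [|a w] //= le_wk rw _.
have [Ea|ne] := eqVneq (last a w) (letter_inv a); last first.
  exists [::], (a :: w); split; rewrite ?cats0 //.
  move: rw; rewrite /reduced /= cat_path /= => -> /=; rewrite andbT.
  by apply: contraNneq ne => E; rewrite [in letter_inv a]E letter_invK.
case/lastP: w Ea le_wk rw => [|w b] /=.
  by move=> /(congr1 snd) /=; case: a.2.
rewrite last_rcons => -> le_wk rw.
have w0 : w != [::] by case: w rw {le_wk} => //=; rewrite /reduced /= eqxx.
have rw' : reduced w.
  by move: rw; rewrite -cats1 => /(@reduced_catr [:: a])/reduced_catl.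
have [|d [e [Ew e0 re]]] := IHk w _ rw' w0.
  by move: le_wk; rewrite size_rcons ltnS => /ltnW.
exists (a :: d), e; split=> //.
by rewrite Ew -[a :: d]cat1s word_inv_cat -cats1 /= -!catA.
Qed.

Lemma expg_cyclic d e k : e != [::] -> reduced (e ++ e) ->
  reduced (d ++ e ++ word_inv d) ->
  fg_of (d ++ e ++ word_inv d) ^+ k.+1 =
    d ++ flatten (nseq k.+1 e) ++ word_inv d :> seq _.
Proof.
move=> e0 ree rd; set E := flatten _.
have rE : reduced (d ++ E ++ word_inv d).
  rewrite {}/E; have red_ed := reduced_catr rd.
  have rde : reduced (d ++ e) by move: rd; rewrite catA => /reduced_catl.
  have r1 : reduced (flatten (nseq k.+1 e) ++ word_inv d).
    elim: k => [|k IHk]; first by rewrite /= cats0.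
    by move: IHk; rewrite /= -!catA => IHk; apply: reduced_glue.
  by move: r1; rewrite /= -!catA => r1; apply: reduced_glue.
have powE : fg_of E = fg_of e ^+ k.+1.
  rewrite /E; elim: k {E rE} => [|k IHk]; first by rewrite /= cats0 expg1.
  by rewrite expgS /= fg_of_cat IHk.
rewrite -(fg_ofK rE); congr word_of; move: E powE {rE} => E powE.
rewrite !fg_of_cat powE fg_of_inv.
elim: k {powE} => [|k IHk]; first by rewrite !expg1.
by rewrite expgS IHk [in RHS]expgS; move: (fg_of e ^+ k.+1) => X; rewrite -!mulgA mulKg.
Qed.

(* Powers of [g = d e d^-1] and of its inverse, [e] cyclically reduced, agree
   exactly on [d]. *)
Lemma diverging_powers g : g != 1 -> exists r, forall N, exists k,
  [/\ N <= size (g ^+ k), N <= size (g^-1 ^+ k) &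
     take r (g ^+ k) != take r (g^-1 ^+ k)].
Proof.
move=> g1; have [|d [e [Eg e0 re]]] := cyclic_decomposition (valP g).
  by apply: contra g1 => /eqP E; apply/eqP/val_inj.
have rg : reduced (d ++ e ++ word_inv d) by rewrite -Eg; apply: (valP g).
have EgV : word_inv (val g) = d ++ word_inv e ++ word_inv d.
  by rewrite Eg !word_inv_cat word_invK -catA.
have rgV : reduced (d ++ word_inv e ++ word_inv d).
  by rewrite -EgV; apply: word_inv_reduced (valP g).
have reV : reduced (word_inv e ++ word_inv e).
  by rewrite -word_inv_cat; apply: word_inv_reduced.
have eV0 : word_inv e != [::] by rewrite -size_eq0 size_word_inv size_eq0.
have {}Eg : g = fg_of (d ++ e ++ word_inv d) by rewrite -Eg word_ofK.
have {}EgV : g^-1 = fg_of (d ++ word_inv e ++ word_inv d).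
  by rewrite -EgV -word_ofV word_ofK.
have szE f k : f != [::] -> k <= size (flatten (nseq k f) : seq (letter T)).
  case: f => // a f _; elim: k => //= k IHk; rewrite size_cat.
  by apply: leq_trans (leq_addl _ _).
exists (size d).+1 => N; exists N.+1.
rewrite {1 3}Eg EgV !expg_cyclic //; split.
- by have := szE e N.+1 e0; move: (flatten _) => F; rewrite !size_cat; lia.
- by have := szE _ N.+1 eV0; move: (flatten _) => F; rewrite !size_cat; lia.
case: e e0 re {szE rg reV rgV eV0 Eg EgV} => // a e _ re.
have takeE f F : f != [::] ->
    take (size d).+1 (d ++ flatten (nseq N.+1 f) ++ F) = rcons d (head a f).
  case: f => // b f _; elim: d => [|c d' /= IHd]; first by rewrite /= take0.
  by rewrite IHd.
rewrite !takeE -?size_eq0 ?size_word_inv // eqseq_rcons eqxx /=.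
(* The inverse of the core begins with the inverse of its last letter; this differs from its head
   because the core followed by itself is reduced. *)
rewrite /word_inv lastI map_rcons rev_rcons /=.
by move: re; rewrite /reduced /= cat_path /= => /and3P[].
Qed.

End Words.

(** * Distance to the subgroup and double cosets *)

Section Cosets.
Variables (T : choiceType) (H : set (free_group T)).
Hypothesis sgH : is_subgroup H.
Implicit Types (x y z g h u : free_group T) (p q : seq (letter T)).

(** [size (h * x)] is the distance from [h^-1] to [x] in the Cayley graph, so this is the
    [M]-neighbourhood of [H]. *)
Definition near_subgroup (M : nat) : set (free_group T) :=
  [set x | exists2 h, H h & size (h * x) <= M].

Definition extends_into p : Prop := exists2 h, H h & prefix p h.

Lemma near_subgroupM M x z :
  near_subgroup M x -> near_subgroup (M + size z) (x * z).
Proof.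
case=> h Hh le; exists h => //; rewrite mulgA.
by apply: leq_trans (size_fgM _ _) _; rewrite leq_add2r.
Qed.

Lemma near_subgroup_cosetl M h x :
  H h -> near_subgroup M (h * x) -> near_subgroup M x.
Proof.
by case: sgH => _ HM _ Hh [k Hk le]; exists (k * h); [apply: HM|rewrite -mulgA].
Qed.

(** The elements of [H] all of whose prefixes are near form a subgroup containing the generators,
    whose maximal length serves as [L]. *)
Lemma extends_into_near : finitely_generated H ->
  exists L, forall p, extends_into p -> near_subgroup L (fg_of p).
Proof.
case: (sgH) => H1 HM HV [s Hs].
pose L := \max_(g <- s) size g; exists L => p [h + hp].
pose K : set (free_group T) := [set h | H h /\
  forall p, prefix p h -> near_subgroup L (fg_of p)].
suff : H `<=` K by move=> HK /HK[_]; apply.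
rewrite {1}Hs; apply: smallest_sub => [|g gs].
  split.
  - split=> // - [|//] _; exists 1 => //; rewrite mul1g.
  - move=> x y [Hx Kx] [Hy Ky]; split; first exact: HM.
    move=> q; have [a [c [b [Ex Ey]]]] := word_mul_cancel y (valP x).
    rewrite word_ofM => -> /prefix_catP[/prefixP[a' Ea]|[b' -> /prefixP[q' Eb]]].
      by apply: Kx; apply/prefixP; exists (a' ++ c); rewrite catA -Ea.
    (* Left translation by [H] preserves nearness; here it turns a prefix of the product into a
       prefix of [y]. *)
    apply: (@near_subgroup_cosetl L x^-1); first exact: HV.
    have -> : x^-1 * fg_of (a ++ b') = fg_of (word_inv c ++ b').
      have Ex' : x = fg_of a * fg_of c by rewrite -fg_of_cat -Ex word_ofK.
      by rewrite Ex' !fg_of_cat invgM -mulgA mulKg fg_of_inv.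
    by apply: Ky; apply/prefixP; exists q'; rewrite Ey Eb catA.
  - move=> x [Hx Kx]; split; first exact: HV.
    (* Translation by [x] turns a prefix of [x^-1] into the inverse of the remaining suffix, which
       is a prefix of [x]. *)
    move=> q /prefixP[q' E]; apply: (@near_subgroup_cosetl L x) => //.
    have -> : x * fg_of q = fg_of (word_inv q').
      have Ex : x^-1 = fg_of q * fg_of q' by rewrite -fg_of_cat -E word_ofK.
      by rewrite -[x]invgK Ex invgM fg_of_inv mulgVK.
    apply: Kx; apply/prefixP; exists (word_inv q).
    by rewrite -word_inv_cat -E word_ofV word_invK.
have Hg : H g by rewrite Hs => A [_]; apply.
split=> // q /prefixP[q' E]; exists 1 => //; rewrite mul1g.
have : size g <= L by apply: leq_bigmax_seq.
have rq : reduced q by move: (valP g); rewrite /= E; apply: reduced_catl.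
rewrite fg_ofK // {1}E size_cat; lia.
Qed.

(* The boundedness of [x H] modulo [H] on the left is inherited by products, so
   it defines a subgroup once imposed on [x] and on [x^-1]. *)
Lemma bounded_double_cosets x : join_complement H (generated [set x]) ->
  (exists M, forall h, H h -> near_subgroup M (x * h)) ->
  (exists M, forall h, H h -> near_subgroup M (x^-1 * h)) ->
  forall y, exists M, forall h, H h -> near_subgroup M (y * h).
Proof.
case: sgH => H1 HM HV gen bx bxV.
pose B : set (free_group T) :=
  [set y | exists M, forall h, H h -> near_subgroup M (y * h)].
pose K : set (free_group T) := [set y | B y /\ B y^-1].
have BH h : H h -> B h.
  move=> Hh; exists 0 => k Hk; exists (h * k)^-1; first by apply/HV/HM.
  by rewrite mulVg.
have BM y z : B y -> B z -> B (y * z).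
  move=> [M bM] [N bN]; exists (M + N) => h /bN[k Hk le].
  (* [k] brings [z * h] to length at most [N], and the compensating [k^-1] lies in [H], so the bound
     for [y] applies to it. *)
  have -> : y * z * h = y * k^-1 * (k * (z * h)) by rewrite !mulgA mulgVK.
  have [l Hl le'] := bM _ (HV _ Hk); exists l => //; rewrite mulgA.
  by apply: leq_trans (size_fgM _ _) _; apply: leq_add.
have [join_all _] := join_cyclicP H x.
have KT : K = [set: free_group T].
  apply: join_all => // [|y Hy]; last by split; apply: BH => //; apply: HV.
  split; first by split; rewrite ?invg1; apply: BH.
    by move=> y z [? ?] [? ?]; split; rewrite ?invgM; apply: BM.
  by move=> y []; rewrite /K /= invgK.
by move=> y; have [] : K y by rewrite KT.
Qed.

End Cosets.

(** * Translates with all positive powers outside the subgroup *)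

Section Cocyclic.
Variables (T : choiceType) (H : set (free_group T)) (L : nat).
Hypothesis sgH : is_subgroup H.
Hypothesis nearL : forall p, extends_into H p -> near_subgroup H L (fg_of p).
Hypothesis farH : forall M, exists x, ~ near_subgroup H M x.
Implicit Types (x y z g h u v : free_group T) (p q s t : seq (letter T)).

(** Cutting off [r] letters brings [x] at most [r] closer to [H], so what remains is beyond [L]. *)
Lemma far_split r x : ~ near_subgroup H (L + r) x ->
  exists p t, [/\ x = p ++ t :> seq _, size t = r & ~ extends_into H p].
Proof.
move=> far; have le_rx : r <= size x.
  rewrite leqNgt; apply/negP => lt_xr; apply: far; exists 1; first by case: sgH.
  by rewrite mul1g; lia.
exists (take (size x - r) x), (drop (size x - r) x); split.
- by rewrite cat_take_drop.
- by rewrite size_drop subKn.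
have szt : size (fg_of (drop (size x - r) x)) = r.
  rewrite fg_ofK ?size_drop ?subKn //.
  by apply: (@reduced_catr _ (take (size x - r) x)); rewrite cat_take_drop (valP x).
move=> /nearL/(near_subgroupM (fg_of (drop (size x - r) x))).
by rewrite szt -fg_of_cat cat_take_drop word_ofK.
Qed.

(** Suitable powers of [g] and [g^-1] differ within their first [r] letters, so one of them avoids
    [t]. *)
Lemma long_elements : (exists2 g, H g & g != 1) ->
  exists r, forall N t, exists h, [/\ H h, N <= size h & take r h != t].
Proof.
case: sgH => H1 HM HV [g Hg /diverging_powers[r div]]; exists r => N t.
have HX z j : H z -> H (z ^+ j).
  by move=> Hz; elim: j => // j IHj; rewrite expgS; apply: HM.
have [k [le1 le2 neq]] := div N.
have [E|ne] := eqVneq (take r (g ^+ k)) t.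
  by exists (g^-1 ^+ k); split=> //; [apply/HX/HV | rewrite -E eq_sym].
by exists (g ^+ k); split=> //; apply: HX.
Qed.

(** If some [l * (x * h)] were short, [l^-1] would be [x * h] times a short element; it would keep
    the prefix [p] of [x], which no element of [H] has. *)
Lemma unbounded_double_coset : (exists2 g, H g & g != 1) ->
  exists x, forall M, exists2 h, H h & ~ near_subgroup H M (x * h).
Proof.
move=> /long_elements[r long].
have [x /far_split[p [t [Ex szt outp]]]] := farH (L + r).
(* Length [r + M] protects the first [r] letters of [h] from a right factor of length at most
   [M]. *)
exists x => M; have [h [Hh leh neh]] := long (r + M) (word_inv t).
exists h => // -[l Hl le]; apply: outp.
exists l^-1; first by case: sgH => _ _; apply.
have -> : l^-1 = x * (h * (l * (x * h))^-1).
  by rewrite !invgM !mulgA mulgK mulgV mul1g.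
rewrite [word_of (x * _)]word_ofM [word_of x]Ex.
apply: (@word_mul_prefix_neq _ _ _ (take r h)) => //.
- by rewrite -Ex; apply: (valP x).
- by rewrite size_takel ?szt //; lia.
rewrite word_ofM -{2}[word_of h](cat_take_drop r).
apply: word_mul_prefix_short; first by rewrite cat_take_drop; apply: (valP h).
by rewrite size_fgV size_drop; lia.
Qed.

Lemma aperiodic_translate u :
  (exists2 g, H g & g != 1) ->
  (forall M, exists2 h, H h & ~ near_subgroup H M (u * h)) ->
  exists g h, [/\ H g, H h & forall k, ~ H ((g * u * h) ^+ k.+1)].
Proof.
move=> /long_elements[r long] unb.
have [h Hh far] := unb (L + r).
have [s [t [Es szt _]]] := far_split far.
set w := u * h in far Es.
(* At most [size w] letters of [z] cancel against [w], so its first [r] letters survive in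
   [z * w]. *)
have [z [Hz lez nez]] := long (r + size w) (word_inv t).
exists z, h; split=> //; rewrite -mulgA -/w => j.
have {}far : ~ near_subgroup H (L + r) (z * w).
  by move=> near; apply: far; apply: near_subgroup_cosetl Hz near.
have [y [t' [Ezw szt' outy]]] := far_split far.
have [p [c [q [Ez Ew Ezw']]]] := word_mul_cancel w (valP z).
have le_rp : r <= size p.
  have Sz : size z = size p + size c by rewrite -size_cat -Ez.
  have Sw : size w = size c + size q.
    by rewrite -(size_word_inv c) -size_cat -Ew.
  by lia.
(* Otherwise [z * w] would be fewer than [r] letters away from a prefix of [z], hence within [L + r]
   of [H]. *)
have le_rq : r <= size q.
  rewrite leqNgt; apply/negP => lt_qr; apply: far.
  have /nearL/(near_subgroupM (fg_of q)) : extends_into H p.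
    by exists z => //; apply/prefixP; exists c.
  rewrite -fg_of_cat -Ezw' -[word_mul z w]/(word_of (z * w)) word_ofK.
  case=> l Hl lel; exists l => //; apply: leq_trans lel _.
  rewrite leq_add2l fg_ofK; first exact: ltnW.
  by apply: (@reduced_catr _ (word_inv c)); rewrite -Ew (valP w).
have Eq : q = take (size q - r) q ++ t.
  rewrite -{1}(cat_take_drop (size q - r) q); congr (_ ++ _).
  have := Ew; rewrite Es -{1}(cat_take_drop (size q - r) q) catA.
  by case/cat_eq_suffix; rewrite // size_drop subKn.
have [Ey Ett] : y = p ++ take (size q - r) q /\ t' = t.
  have := Ezw; rewrite [word_of _]Ezw' {1}Eq catA.
  by case/cat_eq_suffix; rewrite ?szt.
have rv : reduced (y ++ t) by rewrite -Ett -Ezw; apply: (valP (z * w)).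
(* [z * w] is [y ++ t], and [y] begins with [take r z], which does not cancel all of [t]; so [y]
   survives each multiplication. *)
have pre i : prefix y ((z * w) ^+ i.+1).
  elim: i => [|i IHi]; first by rewrite expg1 Ezw; apply/prefixP; exists t'.
  rewrite expgS word_ofM Ezw Ett; apply: (@word_mul_prefix_neq _ _ _ (take r z)) => //.
    by rewrite size_takel ?szt //; lia.
  apply: prefix_trans IHi; rewrite Ey [word_of z]Ez takel_cat //.
  by apply/prefixP; exists (drop r p ++ take (size q - r) q); rewrite catA cat_take_drop.
by move=> Hv; apply: outy; exists ((z * w) ^+ j.+1).
Qed.

End Cocyclic.

(** * Infinite index and the choice of the complement *)

Lemma infinite_index_far (T : finType) (H : set (free_group T)) :
  is_subgroup H -> infinite_index H -> forall M, exists x, ~ near_subgroup H M x.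
Proof.
move=> [H1 HM HV] infH M; apply/not_existsP => near; apply: infH.
(* There are finitely many words of length at most [M]. The inverse passes from cosets [H x],
   measured by [near_subgroup], to the cosets [x H] counted by the index. *)
pose F (b : {bseq M of T * bool}) := left_coset (fg_of b)^-1 H.
apply: (@sub_finite_set _ _ (F @` setT)); last exact/finite_image/finite_finset.
move=> _ [x _ <-]; have [h Hh le] : near_subgroup H M x^-1.
  exact: contrapT (near _).
exists (Bseq le) => //; have -> : F (Bseq le) = left_coset (x * h^-1) H.
  by rewrite /F (word_ofK (h * x^-1)) invgM invgK.
apply/seteqP; split=> _ [k Hk <-].
  by exists (h^-1 * k); [apply: HM => //; apply: HV | rewrite mulgA].
by exists (h * k); [apply: HM | rewrite mulgA mulgVK].
Qed.

Lemma join_cocyclic_direct (T : finType) (H : set (free_group T)) :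
  is_subgroup H -> finitely_generated H -> infinite_index H ->
  join_cocyclic H -> direct_cocyclic H.
Proof.
move=> sgH fgH infH [u gen]; have [H1 HM HV] := sgH.
have [nt|triv] := pselect (exists2 g, H g & g != 1); last first.
  exists u; split=> //; apply/seteqP; split=> [x [Hx _]|_ ->].
    by apply: contrapT => /eqP x1; apply: triv; exists x.
  by split=> //; case: (generated_subgroup [set u]).
have [L nearL] := extends_into_near sgH fgH.
have farH := infinite_index_far sgH infH.
(* Trying [u] and [u^-1] suffices: if both fail, every double coset of [H] is bounded, contrary to
   the case of [x] below. *)
have [w [genw unb]] : exists w, join_complement H (generated [set w]) /\
    forall M, exists2 h, H h & ~ near_subgroup H M (w * h).
  apply: contrapT => /forallNP no_w.
  have [x unbx] := unbounded_double_coset sgH nearL farH nt.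
  have bounded w : join_complement H (generated [set w]) ->
      exists M, forall h, H h -> near_subgroup H M (w * h).
    move=> genw; apply: contrapT => /forallNP unb; apply: (no_w w); split=> // M.
    apply: contrapT => noh; apply: (unb M) => h Hh.
    by apply: contrapT => far; apply: noh; exists h.
  have genV : join_complement H (generated [set u^-1]).
    apply/join_cyclicP => K sgK HK KuV; apply: (iffLR (join_cyclicP H u)) => //.
    by case: sgK => _ _ KV; rewrite -[u]invgK; apply: KV.
  have [M bM] := bounded_double_cosets sgH gen (bounded _ gen) (bounded _ genV) x.
  by have [h Hh] := unbx M; apply; apply: bM.
have [g [h [Hg Hh ap]]] := aperiodic_translate sgH nearL nt unb.
set v := g * w * h in ap; exists v; split.
  apply/join_cyclicP => K sgK HK Kv; apply: (iffLR (join_cyclicP H w)) => //.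
  have -> : w = g^-1 * v * h^-1 by rewrite /v -!mulgA mulKg mulgV mulg1.
  case: sgK => _ KM KV; apply: (KM (g^-1 * v)); last exact/KV/HK.
  by apply: (KM g^-1) => //; apply/KV/HK.
apply/seteqP; split=> [x [Hx]|_ ->]; last first.
  by split=> //; case: (generated_subgroup [set v]).
(* Exponent zero gives the identity; negative powers reduce to positive ones by inversion in [H]. *)
case/generated_cycle => -[|k] [] E; rewrite ?E ?invg1 // in Hx *.
  by case: (ap k).
by case: (ap k); rewrite -[_ ^+ _]invgK; apply: HV.
Qed.

Theorem theorem7p7 (n : nat) (H : set (free_group_rank n)) :
  is_subgroup H -> finitely_generated H -> infinite_index H ->
  (direct_cocyclic H <-> join_cocyclic H).
Proof.
move=> sgH fgH infH; split=> [[u [gen _]]|]; first by exists u.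
exact: (@join_cocyclic_direct 'I_n H).
Qed.
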